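(* For every positive integer $n$ and every real matrix $A=(a_{ij})\in\mathrm{TSSCPP}(n)$, the following inequalities hold: $$\sum_{j'=1}^{j}a_{i+1,j'}+\sum_{i'=1}^{i+1}a_{i',j+1}\ge1\quad\text{for all }1\le i\le n-2,\ 1\le j\le n-2,\ i+j\ge n-1;$$ $$\sum_{j'=1}^{j+1}a_{2,j'}+\sum_{j'=j+1}^{n}a_{1,j'}\ge1\quad\text{for all }1\le j\le n-3;$$ $$\sum_{i'=1}^{i+1}a_{i',2}+\sum_{i'=i+1}^{n}a_{i',1}\ge1\quad\text{for all }1\le i\le n-3.$$
   Context: An $n\times n$ magog matrix is an $n\times n$ matrix $A=(a_{ij})$ with entries in $\{0,1,-1\}$ such that all row sums and all column sums equal $1$, $0\le \sum_{i'=1}^{i}a_{i'j}\le 1$ for all $1\le i,j\le n$, $\sum_{j'=1}^{j}a_{ij'}\ge 0$ for all $1\le i,j\le n$, and for all $1\le i\le n-2$, $1\le j\le n-2$, $$\sum_{j'=1}^{j}a_{i+1,j'}+\sum_{i'=1}^{i+1}a_{i',j+1}-\sum_{i'=1}^{i}a_{i'j}\ge 0.$$ $\mathrm{TSSCPP}(n)\subseteq\mathbb{R}^{n\times n}$ is the convex hull of all $n\times n$ magog matrices. *)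

(* Defs.v *)
From mathcomp Require Import all_boot all_order all_algebra.
From mathcomp Require Import boolp classical_sets reals convex.
Set Implicit Arguments.
Unset Strict Implicit.
Unset Printing Implicit Defensive.
Import Order.TTheory GRing.Theory Num.Theory.
Local Open Scope classical_set_scope.
Local Open Scope ring_scope.

(* Entry a_{ij} with 1-based indices i and j: entry A i.+1 j.+1 is A i j.
   Only indices between 1 and n are ever used; the value 0 beyond n and the
   identification of index 0 with index 1 are junk. *)
Definition entry (R : realType) (n : nat) (A : 'M[R]_n) (i j : nat) : R :=
  if (insub i.-1, insub j.-1) is (Some k, Some l) then A k l else 0.

(* In the last condition, n - 2 is truncated: the range is empty for n <= 2. *)
Definition magog (R : realType) (n : nat) (A : 'M[R]_n) : Prop :=
  [/\ forall i j : 'I_n, A i j \in [:: 0; 1; -1],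
      (forall i : 'I_n, \sum_j A i j = 1) /\
      (forall j : 'I_n, \sum_i A i j = 1),
      forall i j : nat, (1 <= i <= n)%N -> (1 <= j <= n)%N ->
        0 <= \sum_(1 <= i' < i.+1) entry A i' j <= 1,
      forall i j : nat, (1 <= i <= n)%N -> (1 <= j <= n)%N ->
        0 <= \sum_(1 <= j' < j.+1) entry A i j' &
      forall i j : nat, (1 <= i <= n - 2)%N -> (1 <= j <= n - 2)%N ->
        0 <= \sum_(1 <= j' < j.+1) entry A i.+1 j'
             + \sum_(1 <= i' < i.+2) entry A i' j.+1
             - \sum_(1 <= i' < i.+1) entry A i' j].

Definition convex_hull (R : realType) (V : lmodType R) (X : set V) : set V :=
  smallest (@convex_set R V) X.

Definition TSSCPP (R : realType) (n : nat) : set 'M[R]_n :=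
  convex_hull [set A : 'M[R]_n | magog A].
Arguments TSSCPP : clear implicits.

(* Main.v *)
(** For a magog matrix [A], let [N i j] = [corner A i j] count the ones in the first [j]
    entries of row [i] of the 0/1 matrix of column partial sums.  Expressing
    the row sums through [N] turns the last magog condition into
    [N i j + (sum of a_{1j}, ..., a_{ij}) <= N i.+1 j.+1], so the last one
    weakly to the left of [j] in row [i] yields [N i j + 1 <= N i.+1 j.+1] as
    soon as [N i j != 0].  When [N i j = 0], the counting identity
    [N i.+1 n = i.+1] takes over.  Each inequality then follows for magog
    matrices, and passes to the convex hull because it is affine. *)
Require Import Defs.
From mathcomp Require Import all_boot all_order all_algebra.
From mathcomp Require Import boolp classical_sets reals convex.
From mathcomp Require Import interval_inference.
From mathcomp Require Import zify lra.
Set Implicit Arguments.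
Unset Strict Implicit.
Unset Printing Implicit Defensive.
Import Order.TTheory GRing.Theory Num.Theory.
Local Open Scope classical_set_scope.
Local Open Scope ring_scope.

(** The half-space [c <= f x] is convex and contains [X], hence contains the smallest convex set
    around [X]. *)
Lemma scalar_ge_convex_hull (R : realType) (V : lmodType R) (X : set V)
    (f : V -> R) (c : R) :
  scalar f -> (forall x, X x -> c <= f x) ->
  forall x, convex_hull X x -> c <= f x.
Proof.
move=> lin_f Xf; apply: smallest_sub => // x y l; rewrite !inE /= => fx fy.
have f0 : f 0 = 0 by have := lin_f 1 0 0; rewrite scaler0 addr0; lra.
have -> : f (conv l x y) = l%:num * f x + (1 - l%:num) * f y.
  (* The trailing [0] gives both summands the shape [a *: u + v] required by [scalar]. *)
  rewrite (_ : conv l x y = l%:num *: x + ((1 - l%:num) *: y + 0)).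
    by rewrite !lin_f f0 /=; lra.
  by rewrite addr0.
have l0 : 0 <= l%:num by [].
have l1 : l%:num <= 1 by [].
nra.
Qed.

Lemma scalarD (R : realType) (V : lmodType R) (f g : V -> R) :
  scalar f -> scalar g -> scalar (fun x => f x + g x).
Proof. by move=> lin_f lin_g a x y /=; rewrite lin_f lin_g; lra. Qed.

Lemma scalar_sum (R : realType) (V : lmodType R) (I : Type) (r : seq I)
    (f : I -> V -> R) :
  (forall i, scalar (f i)) -> scalar (fun x => \sum_(i <- r) f i x).
Proof.
move=> lin_f a x y /=; rewrite mulr_sumr -big_split.
by apply: eq_bigr => i _; rewrite lin_f.
Qed.

Section Entries.
Variables (R : realType) (n : nat).
Implicit Type A : 'M[R]_n.

Lemma entry_scalar i j : scalar (fun A => entry A i j).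
Proof.
move=> a A B; rewrite /entry.
case: (insub i.-1 : option 'I_n) => [k|];
  case: (insub j.-1 : option 'I_n) => [l|]; rewrite ?mxE //; lra.
Qed.

Definition rowsum A i j := \sum_(1 <= j' < j.+1) entry A i j'.
Definition colsum A i j := \sum_(1 <= i' < i.+1) entry A i' j.
Definition corner A i j := \sum_(1 <= j' < j.+1) colsum A i j'.

Lemma corner0 A i : corner A i 0 = 0.
Proof. by rewrite /corner big_geq. Qed.

Lemma cornerS A i j : corner A i j.+1 = corner A i j + colsum A i j.+1.
Proof. by rewrite /corner big_nat_recr. Qed.

Lemma corner_rowsum A i j : corner A i.+1 j = corner A i j + rowsum A i.+1 j.
Proof.
by rewrite -big_split; apply: eq_bigr => k _; rewrite /colsum big_nat_recr.
Qed.

End Entries.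

Section Magog.
Variables (R : realType) (n : nat) (A : 'M[R]_n).
Hypothesis magogA : magog A.

Lemma entry_ord (i j : 'I_n) : entry A i.+1 j.+1 = A i j.
Proof. by rewrite /entry /= !valK. Qed.

Lemma rowsum_total i : (1 <= i <= n)%N -> rowsum A i n = 1.
Proof.
case: i => // i ltin; have [_ [sum1 _] _ _ _] := magogA.
rewrite -(sum1 (Ordinal ltin)) /rowsum big_add1 big_mkord.
by apply: eq_bigr => j _; rewrite -entry_ord.
Qed.

Lemma colsum_total j : (1 <= j <= n)%N -> colsum A n j = 1.
Proof.
case: j => // j ltjn; have [_ [_ sum1] _ _ _] := magogA.
rewrite -(sum1 (Ordinal ltjn)) /colsum big_add1 big_mkord.
by apply: eq_bigr => i _; rewrite -entry_ord.
Qed.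

Lemma colsum_bounds i j : (1 <= i <= n)%N -> (1 <= j <= n)%N ->
  0 <= colsum A i j <= 1.
Proof. by have [_ _ /(_ i j)] := magogA. Qed.

Lemma rowsum_ge0 i j : (1 <= i <= n)%N -> (1 <= j <= n)%N -> 0 <= rowsum A i j.
Proof. by have [_ _ _ /(_ i j)] := magogA. Qed.

Lemma entry_int i j : entry A i j \is a Num.int.
Proof.
have [ent _ _ _ _] := magogA; rewrite /entry.
case: (insub i.-1 : option 'I_n) => [k|]; last exact: rpred0.
case: (insub j.-1 : option 'I_n) => [l|]; last exact: rpred0.
by move: (ent k l); rewrite !inE => /or3P[] /eqP->;
  rewrite ?rpredN ?rpred0 ?rpred1.
Qed.

(** A column partial sum is an integer lying in the interval from 0 to 1. *)
Lemma colsum01 i j : (1 <= i <= n)%N -> (1 <= j <= n)%N ->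
  colsum A i j = 0 \/ colsum A i j = 1.
Proof.
move=> li lj; have := colsum_bounds li lj.
have /intrP[m ->] : colsum A i j \is a Num.int.
  by apply: rpred_sum => k _; apply: entry_int.
rewrite ler0z -[1]/(1%:~R) ler_int => m01.
have [->|->] : m = 0 \/ m = 1; [lia|by left|by right].
Qed.

Lemma cornerS_magog i j : (1 <= i <= n - 2)%N -> (1 <= j <= n - 2)%N ->
  corner A i j + colsum A i j <= corner A i.+1 j.+1.
Proof.
move=> li lj; rewrite cornerS corner_rowsum.
have [_ _ _ _ /(_ i j li lj)] := magogA.
rewrite -/(rowsum A i.+1 j) -/(colsum A i.+1 j.+1) -/(colsum A i j); lra.
Qed.

(** Each further column contributes a partial sum between 0 and 1. *)
Lemma corner_mono i j k : (1 <= i <= n)%N -> (j <= k <= n)%N ->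
  corner A i j <= corner A i k <= corner A i j + (k - j)%:R.
Proof.
move=> li /andP[lejk]; rewrite -(subnKC lejk) addKn.
elim: (k - j)%N => [|d IH] lekn; first by rewrite addn0; lra.
rewrite addnS cornerS -[d.+1]addn1 natrD.
have /IH : (j + d <= n)%N by lia.
have := @colsum_bounds i (j + d).+1 li ltac:(lia); lra.
Qed.

Lemma corner_total i : (i <= n)%N -> corner A i n = i%:R.
Proof.
elim: i => [|i IH] lein.
  by rewrite /corner big1 // => j _; rewrite /colsum big_geq.
rewrite corner_rowsum IH ?rowsum_total; try lia.
by rewrite -[i.+1]addn1 natrD.
Qed.

(** Induction on [j] searches leftwards for the last one in row [i]: at a one, [cornerS_magog]
    concludes; at a zero, [corner A i] is unchanged and the bound for the previous column carries
    over by monotonicity in row [i.+1]. *)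
Lemma corner_step i j : (1 <= i <= n - 2)%N -> (j <= n - 2)%N ->
  corner A i j = 0 \/ corner A i j + 1 <= corner A i.+1 j.+1.
Proof.
move=> li; elim: j => [|j IH] lj; first by left; apply: corner0.
have [||c0|c1] := @colsum01 i j.+1; try lia; last first.
  by right; rewrite -c1; apply: cornerS_magog; lia.
rewrite (cornerS A i) c0 addr0; have [|?|le_c] := IH; [lia|by left|right].
apply: le_trans le_c _.
by have /andP[] := @corner_mono i.+1 j.+1 j.+2 ltac:(lia) ltac:(lia).
Qed.

Lemma magog_antidiagonal i j : (1 <= i <= n - 2)%N -> (1 <= j <= n - 2)%N ->
  (n - 1 <= i + j)%N -> 1 <= rowsum A i.+1 j + colsum A i.+1 j.+1.
Proof.
move=> li lj lij.
suff : corner A i j + 1 <= corner A i.+1 j.+1 by rewrite cornerS corner_rowsum; lra.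
have [||c0|//] := @corner_step i j; try lia.
(* Of the [i.+1] ones in row [i.+1] of the partial-sum matrix, at most [n - j.+1] lie beyond column
   [j.+1]; since [n - 1 <= i + j], at least one remains. *)
have := @corner_mono i.+1 j.+1 n ltac:(lia) ltac:(lia).
rewrite corner_total ?c0; last lia.
have : (1 + (n - j.+1))%:R <= i.+1%:R :> R by rewrite ler_nat; lia.
rewrite natrD; lra.
Qed.

(** As row 1 sums to 1, the claim is [rowsum A 1 j <= rowsum A 2 j.+1]. It follows from
    [corner_step], because [corner A 1 j.+1] is at most 1. *)
Lemma magog_first_rows j : (1 <= j <= n - 3)%N ->
  1 <= rowsum A 2 j.+1 + \sum_(j.+1 <= j' < n.+1) entry A 1 j'.
Proof.
move=> lj; have := @rowsum_total 1 ltac:(lia).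
rewrite /rowsum (@big_cat_nat _ _ _ j.+1) /=; try lia.
rewrite -!/(rowsum A _ _).
have corner1 k : corner A 1 k = rowsum A 1 k.
  rewrite corner_rowsum /corner big1 ?add0r // => l _.
  by rewrite /colsum big_geq.
have := @rowsum_ge0 2 j.+1 ltac:(lia) ltac:(lia).
have := corner_rowsum A 1 j.+1.
have := @corner_mono 1 j.+1 n ltac:(lia) ltac:(lia).
rewrite corner_total; last lia.
by have [|||] := @corner_step 1 j; try lia; rewrite !corner1; lra.
Qed.

(** The claim amounts to [colsum A i 1 <= colsum A i.+1 2]. For [j = 1], [cornerS_magog] counts
    [colsum A i 1] twice on the left, while [colsum A i.+1 1] on the right is at most 1. *)
Lemma magog_first_columns i : (1 <= i <= n - 3)%N ->
  1 <= colsum A i.+1 2 + \sum_(i.+1 <= i' < n.+1) entry A i' 1.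
Proof.
move=> li; have := @colsum_total 1 ltac:(lia).
rewrite /colsum (@big_cat_nat _ _ _ i.+1) /=; try lia.
rewrite -!/(colsum A _ _).
have := @cornerS_magog i 1 ltac:(lia) ltac:(lia).
rewrite !cornerS !corner0.
have := @colsum_bounds i.+1 1 ltac:(lia) ltac:(lia).
have := @colsum_bounds i.+1 2 ltac:(lia) ltac:(lia).
by have [||->|->] := @colsum01 i 1; try lia; lra.
Qed.

End Magog.

Theorem theorem4p5 (R : realType) (n : nat) (n_gt0 : (0 < n)%N)
    (A : 'M[R]_n) (A_TSSCPP : A \in TSSCPP R n) :
  [/\ forall i j : nat, (1 <= i <= n - 2)%N -> (1 <= j <= n - 2)%N ->
        (n - 1 <= i + j)%N ->
        1 <= \sum_(1 <= j' < j.+1) entry A i.+1 j'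
             + \sum_(1 <= i' < i.+2) entry A i' j.+1,
      forall j : nat, (1 <= j <= n - 3)%N ->
        1 <= \sum_(1 <= j' < j.+2) entry A 2 j'
             + \sum_(j.+1 <= j' < n.+1) entry A 1 j' &
      forall i : nat, (1 <= i <= n - 3)%N ->
        1 <= \sum_(1 <= i' < i.+2) entry A i' 2
             + \sum_(i.+1 <= i' < n.+1) entry A i' 1].
Proof.
move: A_TSSCPP; rewrite inE => hullA.
(* All three inequalities bound a sum of two linear functionals below by 1, so magog matrices
   suffice. *)
have affine (f g : 'M[R]_n -> R) : scalar f -> scalar g ->
    (forall B, magog B -> 1 <= f B + g B) -> 1 <= f A + g A.
  move=> lin_f lin_g magog_fg.
  exact: (scalar_ge_convex_hull (scalarD lin_f lin_g) magog_fg hullA).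
have row i s : scalar (fun B : 'M[R]_n => \sum_(j <- s) entry B i j).
  by apply: scalar_sum => j; apply: entry_scalar.
have col j s : scalar (fun B : 'M[R]_n => \sum_(i <- s) entry B i j).
  by apply: scalar_sum => i; apply: entry_scalar.
split=> [i j li lj lij|j lj|i li].
- apply: (affine _ _ (row _ _) (col _ _)) => B magogB.
  exact: magog_antidiagonal.
- apply: (affine _ _ (row _ _) (row _ _)) => B magogB.
  exact: magog_first_rows.
- apply: (affine _ _ (col _ _) (col _ _)) => B magogB.
  exact: magog_first_columns.
Qed.
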